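(* 2-Colored Token Swapping is solvable in linear time (in the number of vertices) when the input graph is a tree.
   Context: A token-placement of a graph $G=(V,E)$ with colors $C=\{1,\dots,c\}$ is a surjective map $f\colon V\to C$. Two distinct token-placements $f,f'$ are adjacent if there is an edge $uv\in E$ with $f'(u)=f(v)$, $f'(v)=f(u)$ and $f'(w)=f(w)$ for all other $w$. A swapping sequence between $f$ and $f'$ is a sequence $f_1=f,\dots,f_h=f'$ of token-placements with consecutive members adjacent; its length is $h-1$. $\mathrm{OPT}(f,f')$ is the minimum length of such a sequence ($\infty$ if none). $c$-Colored Token Swapping is the decision problem: given $G$, token-placements $f_0,f_t\colon V\to\{1,\dots,c\}$ and an integer $\ell\ge0$, decide whether $\mathrm{OPT}(f_0,f_t)\le\ell$. *)

(* Defs.v *)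
From mathcomp Require Import all_boot.
Set Implicit Arguments. Unset Strict Implicit. Unset Printing Implicit Defensive.

Definition simple_graph (n : nat) (e : rel 'I_n) : Prop :=
  symmetric e /\ irreflexive e.

Definition connected_graph (n : nat) (e : rel 'I_n) : Prop :=
  forall u v : 'I_n, connect e u v.

Definition acyclic_graph (n : nat) (e : rel 'I_n) : Prop :=
  forall s : seq 'I_n, 3 <= size s -> uniq s -> ~~ cycle e s.

Definition is_tree (n : nat) (e : rel 'I_n) : Prop :=
  [/\ simple_graph e, connected_graph e & acyclic_graph e].

Definition edge_listing (n : nat) (e : rel 'I_n) (es : seq ('I_n * 'I_n)) : Prop :=
  (forall p, p \in es -> e p.1 p.2) /\
  (forall u v, e u v -> count (fun p => (p == (u, v)) || (p == (v, u))) es = 1).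

(* colors {1,...,c} are represented by 'I_c *)
Definition token_placement (n c : nat) (f : {ffun 'I_n -> 'I_c}) : Prop :=
  forall k : 'I_c, exists v, f v = k.

Definition tp_adjacent (n c : nat) (e : rel 'I_n) (f g : {ffun 'I_n -> 'I_c}) : Prop :=
  [/\ token_placement f, token_placement g, f <> g &
   exists u v, [/\ e u v, g u = f v, g v = f u &
                   forall w, w != u -> w != v -> g w = f w]].

(* fs = [:: f_1; ...; f_h] is a swapping sequence from f to g; its length is h-1 *)
Definition swapping_sequence (n c : nat) (e : rel 'I_n) (f g : {ffun 'I_n -> 'I_c})
    (fs : seq {ffun 'I_n -> 'I_c}) : Prop :=
  exists rest, [/\ fs = f :: rest, last f rest = g &
    forall i, i < size rest -> tp_adjacent e (nth f fs i) (nth f fs i.+1)].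

(* OPT(f,g) <= l  (false when OPT = infinity) *)
Definition OPT_le (n c : nat) (e : rel 'I_n) (f g : {ffun 'I_n -> 'I_c}) (l : nat) : Prop :=
  exists fs, swapping_sequence e f g fs /\ (size fs).-1 <= l.

Inductive instr : Type :=
  | IConst (r k : nat)
  | IAdd (r a b : nat)
  | ISub (r a b : nat)        (* R[r] := R[a] - R[b] (truncated) *)
  | ILoad (r a : nat)
  | IStore (a b : nat)
  | IJz (r tgt : nat)
  | IJmp (tgt : nat)
  | IHalt.

Record config := Config { pc : nat; memory : nat -> nat }.

Definition upd (m : nat -> nat) (a v : nat) : nat -> nat :=
  fun x => if x == a then v else m x.

(* one step; a halted configuration (pc at IHalt or outside P) is a fixpoint *)
Definition step (P : seq instr) (c : config) : config :=
  let m := memory c in let p := pc c in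
  match nth IHalt P p with
  | IConst r k => Config p.+1 (upd m r k)
  | IAdd r a b => Config p.+1 (upd m r (m a + m b))
  | ISub r a b => Config p.+1 (upd m r (m a - m b))
  | ILoad r a => Config p.+1 (upd m r (m (m a)))
  | IStore a b => Config p.+1 (upd m (m a) (m b))
  | IJz r tgt => if m r == 0 then Config tgt m else Config p.+1 m
  | IJmp tgt => Config tgt m
  | IHalt => c
  end.

Definition halted (P : seq instr) (c : config) : bool :=
  if nth IHalt P (pc c) is IHalt then true else false.

Definition run (P : seq instr) (t : nat) (c : config) : config := iter t (step P) c.

Definition encode (n : nat) (es : seq ('I_n * 'I_n)) (f0 ft : {ffun 'I_n -> 'I_2})
    (l : nat) : nat -> nat :=
  let tape := [:: n, l
               & [seq nat_of_ord (f0 i) | i <- enum 'I_n] ++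
                 [seq nat_of_ord (ft i) | i <- enum 'I_n] ++
                 flatten [seq [:: nat_of_ord p.1; nat_of_ord p.2] | p <- es]] in
  fun x => nth 0 tape x.

(* Main.v *)
Require Import Defs.
From mathcomp Require Import all_boot order ssralg ssrnum ssrint zify.
Import Order.TTheory GRing.Theory Num.Theory.
Set Implicit Arguments. Unset Strict Implicit. Unset Printing Implicit Defensive.

(* Root the tree. For every vertex [v] let [D v] be the number of tokens of color 1 that [f0]
   places in the subtree of [v] minus the number that [ft] places there. A swap along the edge
   from [v] to its parent changes [D v] by at most one and no other value of [D], so
   [sum |D v|] swaps are necessary. They also suffice: as long as [D] is not zero, walking along
   the flow [D] through vertices of color 1, and symmetrically backwards through vertices of
   color 0, one meets an edge with a flow from a token of color 1 to a token of color 0;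
   swapping it lowers the sum by one.

   The sum is computed by peeling leaves. For each vertex it suffices to store its degree and
   the sum of the indices of its unpeeled neighbours: at a leaf this sum is its unique
   neighbour, which becomes its parent. When the peeling of [v] turns its parent into a leaf
   the parent is handled at once, so a single scan over the vertices peels the tree down to one
   vertex, the root. *)

(** * Rooting a tree by peeling leaves *)

Definition active_nbrs (n : nat) (e : rel 'I_n) (S : {set 'I_n}) (v : 'I_n) : {set 'I_n} :=
  [set u | e u v & u \notin S].

(* [S] is the set of vertices peeled so far, in the order given by [rank]; the value [n] of
   [rank] marks the vertices that remain. *)
Definition partial_rooting (n : nat) (e : rel 'I_n) (S : {set 'I_n})
    (par : 'I_n -> 'I_n) (rank : 'I_n -> nat) : Prop :=
  [/\ forall v, v \in S -> e v (par v),
      forall v, v \notin S -> par v = v /\ rank v = n,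
      forall v, v \in S -> rank v < #|S|,
      forall v, v \in S -> rank v < rank (par v) &
      forall u v, e u v -> u \in S -> par u = v \/ v \in S /\ par v = u].

Lemma partial_rooting0 (n : nat) (e : rel 'I_n) :
  partial_rooting e set0 id (fun=> n).
Proof. by split=> [v|v|v|v|u v _]; rewrite inE. Qed.

Lemma active_nbrs1 (n : nat) (e : rel 'I_n) (S : {set 'I_n}) (v : 'I_n) :
  simple_graph e -> #|active_nbrs e S v| = 1 ->
  exists p, [/\ active_nbrs e S v = [set p], p \notin S, e v p & p != v].
Proof.
move=> [sym irr] /eqP/cards1P [p Np]; exists p.
have : p \in active_nbrs e S v by rewrite Np set11.
rewrite inE => /andP [epv pS]; rewrite sym; split=> //.
by apply: contraTneq epv => ->; rewrite irr.
Qed.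

Lemma ltn_card_notin (n : nat) (S : {set 'I_n}) (v : 'I_n) : v \notin S -> #|S| < n.
Proof.
move=> vS; rewrite -[X in _ < X]card_ord -cardsT; apply: proper_card.
by apply/properP; split; [apply: subsetT | exists v].
Qed.

(** The new rank [#|S|] exceeds all ranks in [S] and is below [n], the rank of the unpeeled parent.
    Every neighbour of [v] other than [p] lies in [S], and since [v] was unpeeled, its edge to [v]
    can only be its parent edge. *)
Lemma partial_rooting_peel (n : nat) (e : rel 'I_n) (S : {set 'I_n})
    (par : 'I_n -> 'I_n) (rank : 'I_n -> nat) (v p : 'I_n) :
  simple_graph e -> partial_rooting e S par rank ->
  v \notin S -> active_nbrs e S v = [set p] ->
  partial_rooting e (v |: S) [eta par with v |-> p] [eta rank with v |-> #|S|].
Proof.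
move=> [sym irr] [H1 H2 H3 H4 H5] vS Np.
have : p \in active_nbrs e S v by rewrite Np set11.
rewrite inE => /andP [epv pS].
have pv : p != v by apply: contraTneq epv => ->; rewrite irr.
have ltSn := ltn_card_notin vS.
split=> [w|w|w|w|u w euw]; rewrite ?inE ?cardsU1 ?vS /=.
- by case: eqVneq => [-> _|_ /H1//]; rewrite sym.
- by rewrite negb_or => /andP [/negPf ->] /H2.
- by case: eqVneq => //= _ /H3 /leq_trans; apply; rewrite add1n.
- case: eqVneq => [-> _|wv /= wS]; first by rewrite (negPf pv) (proj2 (H2 _ pS)).
  by case: (eqVneq (par w) v) => [_|_]; [apply: H3 | apply: H4].
- case: (eqVneq u v) euw => [-> evw _|uv euw /= uS].
    have wv : w != v by apply: contraTneq evw => ->; rewrite irr.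
    rewrite (negPf wv) /=; case: (boolP (w \in S)) => wS.
      have := H5 w v; rewrite sym evw wS => /(_ isT isT) [->|[]]; first by right.
      by rewrite (negPf vS).
    by left; apply/eqP; rewrite eq_sym -in_set1 -Np inE sym evw.
  case: (eqVneq w v) (H5 u w euw uS) => [->|_] [->|[wS pw]]; do ?[by left | by right].
  by rewrite wS in vS.
Qed.

(* A leafless nonempty set of active edges would let a simple path grow forever. *)
Lemma leafless_edgeless (n : nat) (e : rel 'I_n) (S : {set 'I_n}) :
  simple_graph e -> acyclic_graph e ->
  (forall v, v \notin S -> #|active_nbrs e S v| <> 1) ->
  forall u v, u \notin S -> v \notin S -> ~~ e u v.
Proof.
move=> [sym irr] acyc leafless u v uS vS; apply/negP => euv.
(* The path grows at its head, whose first two vertices are kept unpeeled: [x] has an active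
   neighbour [z] other than [y], and [z] on the path would close a cycle. *)
have long k : exists x y s,
    [/\ size s = k, path e x (y :: s), uniq (x :: y :: s), x \notin S & y \notin S].
  elim: k => [|k [x [y [s [sz ps us xS yS]]]]].
    exists u, v, [::]; split=> //=; first by rewrite euv.
    by rewrite inE andbT; apply: contraTneq euv => ->; rewrite irr.
  have /andP [exy pys] : e x y && path e y s by [].
  have yN : y \in active_nbrs e S x by rewrite inE sym exy yS.
  have : 0 < #|active_nbrs e S x :\ y|.
    by case: posnP (leafless x xS) => // N0 []; rewrite (cardsD1 y) yN N0.
  case/card_gt0P => z; rewrite !inE => /and3P [zy ezx zS].
  have zx : z != x by apply: contraTneq ezx => ->; rewrite irr.
  exists z, x, (y :: s); split=> //; first by rewrite /= sz.
    by apply/andP; split.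
  rewrite cons_uniq us andbT !inE (negPf zx) (negPf zy) /=; apply/negP => zs.
  case/splitPr: zs us ps sz => s1 s2 us ps _.
  suff : ~~ cycle e (x :: y :: rcons s1 z).
    rewrite /= rcons_path last_rcons ezx andbT exy.
    move: pys ps; rewrite /= -cat_rcons cat_path => _ /and3P [_ ->].
    by [].
  apply: acyc; first by rewrite /= size_rcons.
  have : uniq ((x :: y :: rcons s1 z) ++ s2) by rewrite /= cat_rcons.
  by rewrite cat_uniq => /andP [].
(* Here the path has [n + 2] distinct vertices. *)
have [x [y [s [sz _ us _ _]]]] := long n.
by have := max_card (mem (x :: y :: s)); rewrite (card_uniqP us) card_ord /= sz; lia.
Qed.

(** Without edges among unpeeled vertices, every edge joins a vertex to its parent. Reaching [r]
    through parents is thus invariant along edges, hence true everywhere, whereas an unpeeled vertex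
    is a fixed point of [par]. *)
Lemma leafless_setC1 (n : nat) (e : rel 'I_n) (S : {set 'I_n})
    (par : 'I_n -> 'I_n) (rank : 'I_n -> nat) (r : 'I_n) :
  is_tree e -> partial_rooting e S par rank ->
  (forall v, v \notin S -> #|active_nbrs e S v| <> 1) -> r \notin S ->
  S = [set~ r].
Proof.
move=> [[sym irr] conn acyc] [H1 H2 H3 H4 H5] leafless rS.
have noedge := leafless_edgeless (conj sym irr) acyc leafless.
have parE u v : e u v -> par u = v \/ par v = u.
  move=> euv; case: (boolP (u \in S)) => uS.
    by have [|[]] := H5 u v euv uS; [left | right].
  case: (boolP (v \in S)) => vS; last by have := noedge u v uS vS; rewrite euv.
  by rewrite sym in euv; have [|[]] := H5 v u euv vS; [right | left].
have stepr x : fconnect par x r = fconnect par (par x) r.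
  apply/idP/idP; last by move/(connect_trans (fconnect1 par x)).
  case/connectP => [[|y s] /=].
    by move=> _ <-; rewrite (proj1 (H2 _ rS)).
  by case/andP => /eqP -> ps ->; apply/connectP; exists s.
have toroot v : fconnect par v r.
  have cl : closed e (fun v => fconnect par v r).
    move=> x y exy; rewrite -!topredE /=.
    by case: (parE _ _ exy) => <-; rewrite -stepr.
  have := closed_connect cl (conn v r).
  by rewrite -!topredE /= connect0 => ->.
apply/setP => v; rewrite in_setC1; apply/idP/idP.
  by apply: contraTneq => ->.
move=> vr; apply/negPn/negP => vS.
have : fconnect par v r := toroot v.
case/connectP => s; elim: s => [_ /= rv|y s IH]; first by rewrite rv eqxx in vr.
by rewrite /= (proj1 (H2 _ vS)) => /andP [/eqP <-]; apply: IH.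
Qed.

(** Leaves are peeled while there are any; the parent of a peeled leaf witnesses that an unpeeled
    vertex remains. This rooting serves to count the edges. *)
Lemma tree_rooting (n : nat) (e : rel 'I_n) (r0 : 'I_n) :
  is_tree e -> exists r par rank, partial_rooting e [set~ r] par rank.
Proof.
move=> te; have [simple _ _] := te.
suff H k : forall (S : {set 'I_n}) par rank r, n - #|S| <= k -> partial_rooting e S par rank ->
    r \notin S -> exists r par rank, partial_rooting e [set~ r] par rank.
  by apply: (H n set0 id (fun=> n) r0); rewrite ?leq_subr ?inE //; exact: partial_rooting0.
elim: k => [|k IH] S par rank r leS rt rS.
  have : S = setT.
    by apply/eqP; rewrite eqEcard subsetT cardsT card_ord; lia.
  by move=> ES; rewrite ES inE in rS.
case: (boolP [exists v, (v \notin S) && (#|active_nbrs e S v| == 1)]).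
  case/existsP => v /andP [vS /eqP /(active_nbrs1 simple) [p [Np pS evp pv]]].
  apply: (IH _ _ _ p _ (partial_rooting_peel simple rt vS Np)).
    by rewrite cardsU1 vS; lia.
  by rewrite !inE negb_or pv.
rewrite negb_exists => /forallP leafless.
exists r, par, rank; rewrite -(leafless_setC1 te rt _ rS) // => v vS /eqP.
by apply/negP; have := leafless v; rewrite vS.
Qed.

(** Each vertex but the root contributes its parent edge in both orientations. Increasing ranks
    prevent two vertices from being each other's parents, so nothing is counted twice. *)
Lemma edge_sum_rooting (n : nat) (e : rel 'I_n) (r : 'I_n)
    (par : 'I_n -> 'I_n) (rank : 'I_n -> nat) :
  simple_graph e -> partial_rooting e [set~ r] par rank ->
  \sum_u \sum_v e u v = n.-1.*2.
Proof.
move=> [sym irr] [H1 H2 H3 H4 H5].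
have eE u v : nat_of_bool (e u v) = ((u != r) && (par u == v)) + ((v != r) && (par v == u)).
  have Sr w : (w \in [set~ r]) = (w != r) by rewrite in_setC1.
  have e_par w : w != r -> e w (par w) by rewrite -Sr => /H1.
  have par_par w : w != r -> par w != r -> par (par w) != w.
    rewrite -!Sr => wr pr; apply/eqP => E; have := H4 _ wr; have := H4 _ pr.
    by rewrite E; lia.
  case: (boolP (e u v)) => euv.
    case: (boolP (u != r)) => ur /=.
      case: eqP => [<-|upv] /=; last first.
        rewrite -Sr in ur.
        have [//|[]] := H5 u v euv ur.
        by rewrite Sr => -> ->; rewrite eqxx.
      by case: (boolP (par u != r)) => //= pr; rewrite (negPf (par_par _ ur pr)).
    have vr : v \in [set~ r].
      by rewrite Sr; apply: contraTneq euv => ->; rewrite -(eqP (negPn ur)) irr.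
    move: euv; rewrite sym => evu.
    have [->|[]] := H5 v u evu vr; last by rewrite Sr (negPf ur).
    by move: vr; rewrite Sr eqxx => ->.
  case: (boolP (u != r)) => ur /=.
    case: eqP => [upv|_] /=; first by rewrite -upv e_par in euv.
    case: (boolP (v != r)) => vr //=.
    by case: eqP => // vpu; rewrite -vpu sym e_par in euv.
  case: (boolP (v != r)) => vr //=.
  by case: eqP => // vpu; rewrite -vpu sym e_par in euv.
under eq_bigr => u _ do under eq_bigr => v _ do rewrite eE.
have one : \sum_u \sum_v ((u != r) && (par u == v) : nat) = n.-1.
  transitivity (\sum_(u | u != r) 1).
    rewrite [RHS]big_mkcond; apply: eq_bigr => u _.
    case: (u != r) => /=; last by rewrite big1.
    by rewrite (bigD1 (par u)) //= eqxx big1 // => v /negPf; rewrite eq_sym => ->.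
  by rewrite sum1_card cardC1 card_ord.
under eq_bigr => u _ do rewrite big_split.
by rewrite big_split /= one exchange_big one addnn.
Qed.

(** * The optimal number of swaps *)

(* [D v] is the net number of tokens of color 1 that must cross from [v] to its parent. *)
Definition tree_flow (n : nat) (r : 'I_n) (par : 'I_n -> 'I_n)
    (f g : 'I_n -> nat) (D : 'I_n -> int) : Prop :=
  forall v, D v = ((f v)%:Z - (g v)%:Z + \sum_(c | (c != r) && (par c == v)) D c)%R.

(** Swapping along such an edge brings [D v] one unit closer to zero. Colors are plain naturals so
    that they can be complemented. *)
Definition helpful_edge (n : nat) (r : 'I_n) (par : 'I_n -> 'I_n)
    (f : 'I_n -> nat) (D : 'I_n -> int) (v : 'I_n) : Prop :=
  v <> r /\ ((0 < D v)%R /\ f v = 1 /\ f (par v) = 0 \/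
             (D v < 0)%R /\ f v = 0 /\ f (par v) = 1).

Lemma sum_lt0_exists (I : finType) (P : pred I) (F : I -> int) :
  (\sum_(i | P i) F i < 0)%R -> exists2 i, P i & (F i < 0)%R.
Proof.
move=> lt0; case: (boolP [exists i, P i && (F i < 0)%R]).
  by case/existsP => i /andP []; exists i.
rewrite negb_exists => /forallP H; suff : (0 <= \sum_(i | P i) F i)%R by lia.
by apply: sumr_ge0 => i Pi; have := H i; rewrite Pi /=; lia.
Qed.

(* [sumrN] and [bigD1] at type [int], in the form in which [lia] recognizes the sums. *)
Lemma sum_opp_int (I : finType) (P : pred I) (F : I -> int) :
  (\sum_(i | P i) - F i = - \sum_(i | P i) F i)%R.
Proof. by rewrite sumrN. Qed.

Lemma sum_intD1 (I : finType) (P : pred I) (F : I -> int) (j : I) : P j ->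
  (\sum_(i | P i) F i = F j + \sum_(i | P i && (i != j)) F i)%R.
Proof. exact: bigD1. Qed.

(** Exchanging the two colors reverses the flow, which halves the case analysis below. *)
Lemma tree_flow_compl (n : nat) (r : 'I_n) (par : 'I_n -> 'I_n)
    (f g : 'I_n -> nat) (D : 'I_n -> int) :
  (forall v, f v <= 1) -> (forall v, g v <= 1) -> tree_flow r par f g D ->
  tree_flow r par (fun v => 1 - f v) (fun v => 1 - g v) (fun v => - D v)%R.
Proof.
move=> f1 g1 flow v; rewrite (flow v) sum_opp_int /=.
by have := f1 v; have := g1 v; lia.
Qed.

Lemma helpful_edge_compl (n : nat) (r : 'I_n) (par : 'I_n -> 'I_n)
    (f : 'I_n -> nat) (D : 'I_n -> int) (v : 'I_n) :
  (forall v, f v <= 1) ->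
  helpful_edge r par (fun v => 1 - f v) (fun v => - D v)%R v -> helpful_edge r par f D v.
Proof.
move=> f1 [vr H]; split=> //.
by have := f1 v; have := f1 (par v); lia.
Qed.

(** Descent from [v]: if [v] has color 0 its edge is helpful; otherwise the balance at [v] forces a
    child with negative flow, whose parent again has color 1. *)
Lemma helpful_edge_below (n : nat) (r : 'I_n) (par : 'I_n -> 'I_n) (rank : 'I_n -> nat)
    (f g : 'I_n -> nat) (D : 'I_n -> int) (v : 'I_n) :
  (forall v, v != r -> rank v < rank (par v)) ->
  (forall v, f v <= 1) -> (forall v, g v <= 1) -> tree_flow r par f g D ->
  v != r -> (D v < 0)%R -> f (par v) = 1 -> exists w, helpful_edge r par f D w.
Proof.
move=> rk f1 g1 flow; move: {2}(rank v).+1 (ltnSn (rank v)) => k.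
elim: k v => // k IH v rv vr Dv fp.
case: (posnP (f v)) => fv; first by exists v; split; [apply/eqP | right].
have := flow v => Dv'.
have /sum_lt0_exists [c /andP [cr /eqP pc] Dc] :
    (\sum_(c | (c != r) && (par c == v)) D c < 0)%R.
  by have := g1 v; lia.
apply: (IH c) => //; first by have := rk c cr; rewrite pc; lia.
by rewrite pc; have := f1 v; lia.
Qed.

(** Climb from [v]: a parent of color 0 makes the edge helpful, a sibling with negative flow starts
    a descent, and otherwise the parent has color 1 and positive flow too. The climb ends because
    the root has no flow. *)
Lemma helpful_edge_above (n : nat) (r : 'I_n) (par : 'I_n -> 'I_n) (rank : 'I_n -> nat)
    (f g : 'I_n -> nat) (D : 'I_n -> int) (v : 'I_n) :
  (forall v, v != r -> rank v < rank (par v)) -> (forall v, rank v <= n) ->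
  (forall v, f v <= 1) -> (forall v, g v <= 1) -> tree_flow r par f g D -> D r = 0%R ->
  (0 < D v)%R -> f v = 1 -> exists w, helpful_edge r par f D w.
Proof.
move=> rk rkn f1 g1 flow Dr; move: {2}(n - rank v).+1 (ltnSn (n - rank v)) => k.
elim: k v => // k IH v rv Dv fv.
have vr : v != r by apply: contraTneq Dv => ->; rewrite Dr.
case: (posnP (f (par v))) => fp; first by exists v; split; [apply/eqP | left].
have {}fp : f (par v) = 1 by have := f1 (par v); lia.
case: (boolP [exists c, [&& c != r, par c == par v & (D c < 0)%R]]).
  case/existsP => c /and3P [cr /eqP pc Dc].
  by apply: helpful_edge_below rk f1 g1 flow cr Dc _; rewrite pc.
rewrite negb_exists => /forallP nonneg.
apply: (IH (par v)) => //; first by have := rk v vr; have := rkn (par v); lia.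
rewrite flow (sum_intD1 _ (j := v)) /=; last by rewrite vr eqxx.
suff : (0 <= \sum_(c | (c != r) && (par c == par v) && (c != v)) D c)%R.
  by move: (\sum_(c | _) _)%R => s; have := g1 (par v); lia.
apply: sumr_ge0 => c /andP [/andP [cr pc] _].
by have := nonneg c; rewrite cr pc /=; lia.
Qed.

Lemma exists_helpful_edge (n : nat) (r : 'I_n) (par : 'I_n -> 'I_n) (rank : 'I_n -> nat)
    (f g : 'I_n -> nat) (D : 'I_n -> int) (v : 'I_n) :
  (forall v, v != r -> rank v < rank (par v)) -> (forall v, rank v <= n) ->
  (forall v, f v <= 1) -> (forall v, g v <= 1) -> tree_flow r par f g D -> D r = 0%R ->
  D v <> 0%R -> exists w, helpful_edge r par f D w.
Proof.
move=> rk rkn f1 g1 flow Dr.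
wlog Dv : f g D f1 g1 flow Dr / (0 < D v)%R.
  move=> H Dv0; case: (ltrP 0%R (D v)) => Dv; first exact: H f1 g1 flow Dr Dv Dv0.
  have [|||||w /(helpful_edge_compl f1)] := H _ _ _ _ _ (tree_flow_compl f1 g1 flow).
  - by move=> u; lia.
  - by move=> u; lia.
  - by rewrite Dr oppr0.
  - lia.
  - lia.
  by exists w.
move=> _; case: (posnP (f v)) => fv; last first.
  by apply: (helpful_edge_above rk rkn f1 g1 flow Dr Dv); have := f1 v; lia.
(* A vertex of color 0 with positive flow receives it from a child; with the colors exchanged, the
   descent starts there. *)
have cflow := tree_flow_compl f1 g1 flow; have := cflow v => cv.
have /sum_lt0_exists [c /andP [cr /eqP pc] Dc] :
    (\sum_(c | (c != r) && (par c == v)) - D c < 0)%R.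
  by rewrite sum_opp_int; have := flow v; lia.
have [|||w /(helpful_edge_compl f1)] := helpful_edge_below (v := c) rk _ _ cflow cr Dc _.
- by move=> u; lia.
- by move=> u; lia.
- by rewrite pc fv.
by exists w.
Qed.

Lemma tree_flow_diag (n : nat) (r : 'I_n) (par : 'I_n -> 'I_n) (rank : 'I_n -> nat)
    (f : 'I_n -> nat) (D : 'I_n -> int) :
  (forall v, v != r -> rank v < rank (par v)) -> tree_flow r par f f D ->
  forall v, D v = 0%R.
Proof.
move=> rk flow v; move: {2}(rank v).+1 (ltnSn (rank v)) => k.
elim: k v => // k IH v rv; rewrite flow subrr add0r big1 // => c /andP [cr /eqP pc].
by apply: IH; have := rk c cr; rewrite pc; lia.
Qed.

Lemma tree_flow0 (n : nat) (r : 'I_n) (par : 'I_n -> 'I_n)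
    (f g : 'I_n -> nat) (D : 'I_n -> int) :
  tree_flow r par f g D -> (forall v, D v = 0%R) -> f =1 g.
Proof.
move=> flow D0 v; have := flow v.
by rewrite big1 => [|c _]; rewrite D0 //; lia.
Qed.

(** The swap changes [f] by opposite amounts at [v] and [par v]. The change of [D v] absorbs both,
    the second one through the sum over the children of [par v]. *)
Lemma tree_flow_swap (n : nat) (r : 'I_n) (par : 'I_n -> 'I_n)
    (f f' g : 'I_n -> nat) (D : 'I_n -> int) (v : 'I_n) :
  v != r -> par v != v ->
  f' v = f (par v) -> f' (par v) = f v ->
  (forall w, w != v -> w != par v -> f' w = f w) ->
  tree_flow r par f g D ->
  tree_flow r par f' g [eta D with v |-> (D v + (f' v)%:Z - (f v)%:Z)%R].
Proof.
move=> vr pv fv fp fo flow w.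
have sumE : (\sum_(c | (c != r) && (par c == w))
      [eta D with v |-> (D v + (f' v)%:Z - (f v)%:Z)] c =
    \sum_(c | (c != r) && (par c == w)) D c
      + (if par v == w then (f' v)%:Z - (f v)%:Z else 0))%R.
  case: eqP => pw; last first.
    rewrite addr0; apply: eq_bigr => c /andP [_ /eqP pc] /=.
    by case: eqP => // cv; case: pw; rewrite -cv.
  rewrite (sum_intD1 _ (j := v)) /=; last by rewrite vr pw eqxx.
  rewrite [in RHS](sum_intD1 _ (j := v)) /=; last by rewrite vr pw eqxx.
  rewrite eqxx (eq_bigr D).
    by rewrite -[RHS]addrA [X in _ = (_ + X)%R]addrC !addrA.
  by move=> c /andP [_ /negPf ->].
rewrite sumE /=; case: eqVneq => [->|wv].
  by rewrite (negPf pv) flow; move: (\sum_(c | _) _)%R => s; lia.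
rewrite flow; move: (\sum_(c | _) _)%R => s.
case: eqP => [<-|/eqP pw]; first by rewrite fv fp; lia.
rewrite fo //; last by rewrite eq_sym.
exact: (congr1 (+%R _) (esym (addr0 _))).
Qed.

(** The additive form avoids truncated subtraction. *)
Lemma sum_absz_upd (n : nat) (r : 'I_n) (D : 'I_n -> int) (v : 'I_n) (x : int) :
  v != r ->
  \sum_(w | w != r) `|[eta D with v |-> x] w|%N + `|D v|%N =
  \sum_(w | w != r) `|D w|%N + `|x|%N.
Proof.
move=> vr; rewrite (bigD1 v) //= eqxx [in RHS](bigD1 v) //=.
rewrite (eq_bigr (fun w => `|D w|%N)); first by lia.
by move=> w /andP [_ /negPf ->].
Qed.

(** * Swapping sequences and the flow *)

Lemma OPT_le_refl (n c : nat) (e : rel 'I_n) (f : {ffun 'I_n -> 'I_c}) :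
  OPT_le e f f 0.
Proof. by exists [:: f]; split=> //; exists [::]. Qed.

Lemma OPT_le_cons (n c : nat) (e : rel 'I_n) (f f' g : {ffun 'I_n -> 'I_c}) (l : nat) :
  tp_adjacent e f f' -> OPT_le e f' g l -> OPT_le e f g l.+1.
Proof.
move=> adj [fs [[s [-> lst steps]] len]]; exists (f :: f' :: s); split=> //.
exists (f' :: s); split=> // -[|i] //= lti.
(* The two uses of [nth] have different default values, which agree within range. *)
have := steps i lti; congr tp_adjacent; apply: set_nth_default => /=.
  by rewrite ltnS ltnW.
by [].
Qed.

Lemma OPT_le_inv (n c : nat) (e : rel 'I_n) (f g : {ffun 'I_n -> 'I_c}) (l : nat) :
  OPT_le e f g l -> f = g \/ exists f' l', [/\ tp_adjacent e f f', OPT_le e f' g l' & l'.+1 = l].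
Proof.
case: l => [|l] [fs [[s [-> lst steps]] len]].
  by left; case: s lst len steps.
case: s lst steps len => [|f' s] lst steps len; first by left.
right; exists f', l; split=> //; first exact: (steps 0).
exists (f' :: s); split=> //; exists s; split=> // i lti.
have := steps i.+1 lti => /=; congr tp_adjacent; apply: set_nth_default => /=.
  by rewrite ltnS ltnW.
by [].
Qed.

Lemma leq_OPT_le (n c : nat) (e : rel 'I_n) (f g : {ffun 'I_n -> 'I_c}) (l l' : nat) :
  l <= l' -> OPT_le e f g l -> OPT_le e f g l'.
Proof. by move=> ll' [fs [sw len]]; exists fs; split=> //; apply: leq_trans ll'. Qed.

Lemma eq_ffun_ord (n : nat) (f g : {ffun 'I_n -> 'I_2}) :
  (fun v => nat_of_ord (f v)) =1 (fun v => nat_of_ord (g v)) -> f = g.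
Proof. by move=> fg; apply/ffunP => v; apply: val_inj; apply: fg. Qed.

(** Induction on the length: a swap alters one value of [D] by at most one, and the flow from [g] to
    itself vanishes. *)
Lemma OPT_le_flow_lower (n : nat) (e : rel 'I_n) (r : 'I_n)
    (par : 'I_n -> 'I_n) (rank : 'I_n -> nat) (f g : {ffun 'I_n -> 'I_2})
    (D : 'I_n -> int) (l : nat) :
  simple_graph e -> partial_rooting e [set~ r] par rank ->
  tree_flow r par (fun v => f v) (fun v => g v) D -> OPT_le e f g l ->
  D r = 0%R /\ \sum_(v | v != r) `|D v|%N <= l.
Proof.
move=> [sym irr] [H1 H2 H3 H4 H5].
have Sr w : (w \in [set~ r]) = (w != r) by rewrite in_setC1.
have rk v : v != r -> rank v < rank (par v) by rewrite -Sr => /H4.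
elim: l f D => [|l IH] f D flow /OPT_le_inv [].
- move=> E; have D0 := tree_flow_diag rk _ ; rewrite E in flow.
  by rewrite (D0 _ _ flow) big1 // => v _; rewrite (D0 _ _ flow).
- by case=> f' [l' []].
- move=> E; have D0 := tree_flow_diag rk _ ; rewrite E in flow.
  by rewrite (D0 _ _ flow) big1 // => v _; rewrite (D0 _ _ flow).
case=> f' [l' [[_ _ _ [x [y [exy fx fy fo]]]] opt [E]]].
rewrite {l'}E in opt.
(* The swapped edge joins a child to its parent; [v] is the child. *)
have [v [vr fv fp fw]] : exists v, [/\ v != r, f' v = f (par v), f' (par v) = f v &
    forall w, w != v -> w != par v -> f' w = f w].
  case: (eqVneq x r) => xr; last first.
    rewrite -Sr in xr; have [pxy|[yr pyx]] := H5 x y exy xr.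
      by exists x; rewrite pxy -Sr; split.
    by exists y; rewrite pyx -Sr; split=> // w wy wx; apply: fo.
  have yr : y \in [set~ r].
    by rewrite Sr -xr; apply: contraTneq exy => ->; rewrite irr.
  rewrite sym in exy; have [pyx|[xr' _]] := H5 y x exy yr.
    by exists y; rewrite pyx -Sr; split=> // w wy wx; apply: fo.
  by rewrite Sr xr eqxx in xr'.
have pv : par v != v.
  by apply/eqP => E; have := rk v vr; rewrite E ltnn.
have flow' := tree_flow_swap (f := fun v => f v) (f' := fun v => f' v) vr pv
  (congr1 (@nat_of_ord 2) fv) (congr1 (@nat_of_ord 2) fp)
  (fun w wv wp => congr1 (@nat_of_ord 2) (fw w wv wp)) flow.
have [] := IH f' _ flow' opt; rewrite /= (eq_sym r) (negPf vr) => D0 lel.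
split=> //.
have := sum_absz_upd D (D v + (f' v : nat)%:Z - (f v : nat)%:Z)%R vr.
by move: lel; have := ltn_ord (f v); have := ltn_ord (f' v) => /=; lia.
Qed.

(** Induction on the sum: while it is positive, a swap along a helpful edge lowers it by one. A swap
    permutes the tokens and so preserves surjectivity. *)
Lemma OPT_le_flow_upper (n : nat) (e : rel 'I_n) (r : 'I_n)
    (par : 'I_n -> 'I_n) (rank : 'I_n -> nat) (f g : {ffun 'I_n -> 'I_2})
    (D : 'I_n -> int) :
  simple_graph e -> partial_rooting e [set~ r] par rank -> token_placement f ->
  tree_flow r par (fun v => f v) (fun v => g v) D -> D r = 0%R ->
  OPT_le e f g (\sum_(v | v != r) `|D v|%N).
Proof.
move=> [sym irr] [H1 H2 H3 H4 H5].
have Sr w : (w \in [set~ r]) = (w != r) by rewrite in_setC1.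
have rk v : v != r -> rank v < rank (par v) by rewrite -Sr => /H4.
have rkn v : rank v <= n.
  case: (boolP (v \in [set~ r])) => [/H3|/H2 [_ ->] //].
  by rewrite cardsC1 card_ord; lia.
move: {2}(\sum_(v | v != r) _) (erefl (\sum_(v | v != r) `|D v|%N)) => k.
have le1 (h : {ffun 'I_n -> 'I_2}) v : h v <= 1 by have := ltn_ord (h v).
elim: k f D => [|k IH] f D sumD tf flow Dr.
  suff -> : f = g by rewrite sumD; exact: OPT_le_refl.
  apply: eq_ffun_ord; apply: (tree_flow0 flow) => v.
  case: (eqVneq v r) => [-> //|vr].
  by move/eqP: sumD; rewrite sum_nat_eq0 => /forallP /(_ v); rewrite vr absz_eq0 => /eqP.
have [v Dv] : exists v, D v <> 0%R.
  case: (boolP [exists v, D v != 0%R]) => [/existsP [v /eqP]|]; first by exists v.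
  rewrite negb_exists => /forallP D0; move: sumD; rewrite big1 // => v _.
  by have := D0 v; rewrite negbK => /eqP ->.
have [{Dv}v [/eqP vr dir]] := exists_helpful_edge rk rkn (le1 f) (le1 g) flow Dr Dv.
pose f' := [ffun w => if w == v then f (par v) else if w == par v then f v else f w].
have pv : par v != v.
  by apply/eqP => E; have := rk v vr; rewrite E ltnn.
have fv : f' v = f (par v) by rewrite ffunE eqxx.
have fp : f' (par v) = f v by rewrite ffunE eqxx (negPf pv).
have fo w : w != v -> w != par v -> f' w = f w.
  by move=> /negPf wv /negPf wp; rewrite ffunE wv wp.
have flow' := tree_flow_swap (f := fun v => f v) (f' := fun v => f' v) vr pv
  (congr1 (@nat_of_ord 2) fv) (congr1 (@nat_of_ord 2) fp)
  (fun w wv wp => congr1 (@nat_of_ord 2) (fo w wv wp)) flow.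
have tf' : token_placement f'.
  move=> i; have [w <-] := tf i.
  case: (eqVneq w v) => [->|wv]; first by exists (par v).
  case: (eqVneq w (par v)) => [->|wp]; first by exists v.
  by exists w; apply: fo.
have := sum_absz_upd D (D v + (f' v : nat)%:Z - (f v : nat)%:Z)%R vr.
rewrite sumD => upd.
have sum' : \sum_(w | w != r)
    `|[eta D with v |-> (D v + (f' v : nat)%:Z - (f v : nat)%:Z)%R] w|%N = k.
  by move: upd dir; rewrite fv /=; lia.
apply: (@OPT_le_cons _ _ _ _ f'); last first.
  by rewrite -sum'; apply: (IH) => //=; rewrite eq_sym (negPf vr).
split=> //; first by move=> E; rewrite -E in fv; move: dir; rewrite fv /=; lia.
by exists v, (par v); split=> //; apply: H1; rewrite Sr.
Qed.

(** [D r = 0] says that both placements use color 1 equally often, a count that swaps preserve. *)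
Lemma OPT_le_flow (n : nat) (e : rel 'I_n) (r : 'I_n)
    (par : 'I_n -> 'I_n) (rank : 'I_n -> nat) (f g : {ffun 'I_n -> 'I_2})
    (D : 'I_n -> int) (l : nat) :
  simple_graph e -> partial_rooting e [set~ r] par rank -> token_placement f ->
  tree_flow r par (fun v => f v) (fun v => g v) D ->
  OPT_le e f g l <-> D r = 0%R /\ \sum_(v | v != r) `|D v|%N <= l.
Proof.
move=> simple rt tf flow; split; first exact: OPT_le_flow_lower rt flow.
by case=> Dr lel; apply: leq_OPT_le lel _; apply: OPT_le_flow_upper rt tf flow Dr.
Qed.

(** * The RAM program *)

(* Cells below 16 serve as registers, the rest is the heap. *)
Definition split_mem (rs : seq nat) (h : nat -> nat) : nat -> nat :=
  fun x => if x < 16 then nth 0 rs x else h x.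

(* [s] is the number of steps already spent out of a total budget of [T]. *)
Definition decides (P : seq instr) (A : Prop) (T s p : nat) (rs : seq nat) (h : nat -> nat) :=
  forall c, pc c = p -> memory c =1 split_mem rs h ->
  exists k, s + k <= T /\ halted P (run P k c) /\ (memory (run P k c) 0 != 0 <-> A).

(** Direct operands must be registers, so that only [ILoad] and [IStore] can touch the heap. *)
Definition regs_ok (i : instr) : bool :=
  match i with
  | IConst r _ => r < 16
  | IAdd r a b | ISub r a b => [&& r < 16, a < 16 & b < 16]
  | ILoad r a => (r < 16) && (a < 16)
  | IStore a b => (a < 16) && (b < 16)
  | IJz r _ => r < 16
  | IJmp _ | IHalt => true
  end.

(** A precondition transformer with continuation [K]. Indirect accesses must hit the heap; halting
    is left to [decides_halt]. *)
Definition effect (i : instr) (K : nat -> seq nat -> (nat -> nat) -> Prop)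
    (p : nat) (rs : seq nat) (h : nat -> nat) : Prop :=
  match i with
  | IConst r k => K p.+1 (set_nth 0 rs r k) h
  | IAdd r a b => K p.+1 (set_nth 0 rs r (nth 0 rs a + nth 0 rs b)) h
  | ISub r a b => K p.+1 (set_nth 0 rs r (nth 0 rs a - nth 0 rs b)) h
  | ILoad r a => 16 <= nth 0 rs a /\ K p.+1 (set_nth 0 rs r (h (nth 0 rs a))) h
  | IStore a b => 16 <= nth 0 rs a /\ K p.+1 rs (upd h (nth 0 rs a) (nth 0 rs b))
  | IJz r tgt => (nth 0 rs r = 0 -> K tgt rs h) /\ (nth 0 rs r <> 0 -> K p.+1 rs h)
  | IJmp tgt => K tgt rs h
  | IHalt => False
  end.

Lemma upd_reg (m : nat -> nat) (rs : seq nat) (h : nat -> nat) (r v : nat) :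
  r < 16 -> m =1 split_mem rs h -> upd m r v =1 split_mem (set_nth 0 rs r v) h.
Proof.
move=> r16 mE x; rewrite /upd mE /split_mem nth_set_nth /=.
by case: eqP => [->|_]; rewrite ?r16.
Qed.

Lemma upd_heap (m : nat -> nat) (rs : seq nat) (h : nat -> nat) (a v : nat) :
  16 <= a -> m =1 split_mem rs h -> upd m a v =1 split_mem rs (upd h a v).
Proof.
move=> a16 mE x; rewrite /upd mE /split_mem.
by case: eqP => [->|_]; rewrite ?(ltnNge a) ?a16.
Qed.

Lemma decides_step (i : instr) (P : seq instr) (A : Prop) (T s p : nat)
    (rs : seq nat) (h : nat -> nat) :
  all regs_ok P -> nth IHalt P p = i -> effect i (decides P A T s.+1) p rs h ->
  decides P A T s p rs h.
Proof.
move=> Pok Pp eff c pcc mc.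
have iok : regs_ok i.
  rewrite -Pp; case: (ltnP p (size P)) => sz; first by rewrite (all_nthP IHalt Pok).
  by rewrite nth_default.
have next p' rs' h' : decides P A T s.+1 p' rs' h' ->
    pc (step P c) = p' -> memory (step P c) =1 split_mem rs' h' ->
    exists k, s + k <= T /\ halted P (run P k c) /\ (memory (run P k c) 0 != 0 <-> A).
  move=> dec pc' mem'; have [k [leT res]] := dec _ pc' mem'.
  by exists k.+1; split; [rewrite addnS | rewrite /run iterSr].
have reg r : r < 16 -> memory c r = nth 0 rs r by rewrite mc /split_mem => ->.
have heap a : 16 <= a -> memory c a = h a by move=> a16; rewrite mc /split_mem ltnNge a16.
case: i iok eff Pp => /= [r k|r a b|r a b|r a|a b|r tgt|tgt|] iok eff Pp //.
- apply: (next _ _ _ eff); rewrite /step pcc Pp //=.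
  exact: (upd_reg _ _ mc).
- case/and3P: iok => ir ia ib.
  apply: (next _ _ _ eff); rewrite /step pcc Pp //= !reg //.
  exact: (upd_reg _ _ mc).
- case/and3P: iok => ir ia ib.
  apply: (next _ _ _ eff); rewrite /step pcc Pp //= !reg //.
  exact: (upd_reg _ _ mc).
- case/andP: iok => ir ia; case: eff => lea eff.
  apply: (next _ _ _ eff); rewrite /step pcc Pp //= (reg a) // heap //.
  exact: (upd_reg _ _ mc).
- case/andP: iok => ia ib; case: eff => lea eff.
  apply: (next _ _ _ eff); rewrite /step pcc Pp //= !reg //.
  exact: (upd_heap _ _ mc).
- case: eff => effz effnz; case: (eqVneq (nth 0 rs r) 0) => z.
    by apply: (next _ _ _ (effz z)); rewrite /step pcc Pp reg // z.
  by apply: (next _ _ _ (effnz (elimN eqP z))); rewrite /step pcc Pp reg // (negPf z).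
- by apply: (next _ _ _ eff); rewrite /step pcc Pp.
Qed.

Lemma decides_halt (P : seq instr) (A : Prop) (T s p : nat) (rs : seq nat) (h : nat -> nat) :
  nth IHalt P p = IHalt -> s <= T -> (nth 0 rs 0 != 0 <-> A) -> decides P A T s p rs h.
Proof.
move=> Pp leT res c pcc mc; exists 0; rewrite addn0 /halted /run /= pcc Pp; split=> //.
by rewrite mc.
Qed.

(** Brings the step count reached by symbolic execution into the form expected next. *)
Lemma decides_spend (P : seq instr) (A : Prop) (T s s' p : nat) (rs : seq nat) (h : nat -> nat) :
  s <= s' -> decides P A T s' p rs h -> decides P A T s p rs h.
Proof.
by move=> ss' dec c pcc mc; have [k [leT res]] := dec c pcc mc; exists k; split=> //; lia.
Qed.

(* The input occupies all the cells from 0 on, so no register is free at first. The first six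
   additions map [(n, l)] invertibly to [(X, Y) = (11n + 7l, 3n + 2l)]; as [X] lies beyond the
   input, [Y] can be saved at address [X], which frees cell 1. Cells 2 to 15 then move to
   addresses [X + 18] to [X + 31], after which the additions are undone by subtractions. *)
Definition boot_code : seq instr :=
  [:: IAdd 1 1 0; IAdd 0 0 1; IAdd 1 1 0; IAdd 0 0 1; IAdd 0 0 1; IAdd 0 0 1;
      IStore 0 1; IConst 1 18; IAdd 1 1 0; IStore 1 2; IConst 2 1]
  ++ flatten [seq [:: IAdd 1 1 2; IStore 1 r] | r <- iota 3 13]
  ++ [:: ILoad 3 0; ISub 0 0 3; ISub 0 0 3; ISub 0 0 3; ISub 3 3 0; ISub 4 0 3; ISub 5 3 4;
      IAdd 3 4 4; IAdd 3 3 3; IConst 6 16; ISub 3 3 6; IConst 9 13; ISub 9 1 9; IAdd 1 1 2].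

(* The rest of the input joins the cells already moved. From here on register 2 holds 1,
   register 4 holds [n], register 5 holds [l], and register 9 holds [X + 18], the new address
   of the input without its first two cells. *)
Definition copy_code : seq instr :=
  [:: IJz 3 58; ILoad 7 6; IStore 1 7; IAdd 6 6 2; IAdd 1 1 2; ISub 3 3 2; IJmp 51].

(* Register 1 points to the array of degrees, which is followed by the array of neighbour sums;
   registers 8 and 11 hold the number of edges left and the position in the edge list. *)
Definition edge_code : seq instr :=
  [:: IAdd 3 4 4; IAdd 11 9 3; IAdd 3 3 3; IAdd 1 9 3; ISub 8 4 2;
      IJz 8 86;
      ILoad 6 11; IAdd 11 11 2; ILoad 7 11; IAdd 11 11 2;
      IAdd 3 1 6; ILoad 12 3; IAdd 12 12 2; IStore 3 12;
      IAdd 3 3 4; ILoad 12 3; IAdd 12 12 7; IStore 3 12;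
      IAdd 3 1 7; ILoad 12 3; IAdd 12 12 2; IStore 3 12;
      IAdd 3 3 4; ILoad 12 3; IAdd 12 12 6; IStore 3 12;
      ISub 8 8 2; IJmp 63].

(* Register 0 accumulates the answer, register 13 scans the vertices, register 6 is the vertex
   that may be peeled, register 7 the parent found last (in the end the root), and register 10
   is 0. The arrays of colors become arrays of subtree counts. *)
Definition peel_code : seq instr :=
  [:: IConst 0 0; IConst 13 0; IConst 7 0; IConst 10 0;
      ISub 3 4 13; IJz 3 129; IAdd 6 13 10; IAdd 13 13 2;
      IAdd 3 1 6; ILoad 12 3; IJz 12 90; ISub 12 12 2; IJz 12 100; IJmp 90;
      IStore 3 12; IAdd 3 3 4; ILoad 7 3;
      IAdd 3 1 7; ILoad 12 3; ISub 12 12 2; IStore 3 12;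
      IAdd 3 3 4; ILoad 12 3; ISub 12 12 6; IStore 3 12;
      IAdd 8 9 6; ILoad 14 8; IAdd 8 8 4; ILoad 15 8;
      ISub 12 14 15; IAdd 0 0 12; ISub 12 15 14; IAdd 0 0 12;
      IAdd 8 9 7; ILoad 12 8; IAdd 12 12 14; IStore 8 12;
      IAdd 8 8 4; ILoad 12 8; IAdd 12 12 15; IStore 8 12;
      IAdd 6 7 10; IJmp 94].

Definition test_code : seq instr :=
  [:: IAdd 8 9 7; ILoad 14 8; IAdd 8 8 4; ILoad 15 8; ISub 12 14 15; ISub 3 15 14;
      IAdd 12 12 3; ISub 0 0 5; IAdd 0 0 12; IJz 0 141; IConst 0 0; IHalt; IConst 0 1; IHalt].

(* The five blocks start at addresses 0, 51, 58, 86 and 129. *)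
Definition swap_program : seq instr :=
  boot_code ++ copy_code ++ edge_code ++ peel_code ++ test_code.

Lemma swap_program_regs_ok : all regs_ok swap_program.
Proof. by []. Qed.

(** Symbolic execution: the instruction is fetched by computation, and [regs] rewrites the resulting
    registers into closed forms by linear arithmetic. *)
Ltac step := match goal with |- decides ?P _ _ _ ?p _ _ =>
  let i := eval vm_compute in (nth IHalt P p) in
  apply: (@decides_step i _ _ _ _ p _ _ swap_program_regs_ok (erefl _)); cbn [effect nth set_nth] end.
Ltac stepm := step; split; [lia|].
Tactic Notation "steps" integer(k) := do k (step; try (split; [lia|])).
Ltac regs l := match goal with |- decides _ _ _ _ _ ?rs _ =>
  replace rs with l by (repeat (apply: f_equal2; [lia|]); reflexivity) end.

Lemma upd_neq (m : nat -> nat) (a v x : nat) : x != a -> upd m a v x = m x.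
Proof. by rewrite /upd => /negPf ->. Qed.

Lemma upd_eq (m : nat -> nat) (a v x : nat) : x = a -> upd m a v x = v.
Proof. by move=> ->; rewrite /upd eqxx. Qed.

(** Blocks are specified in continuation form. As [2 <= n], the address [X] is at least 22, hence in
    the heap. The input of a tree has [4 * n] cells, so [4 * n - 16] of them remain to be moved,
    none if the input is shorter. *)
Lemma boot_correct (A : Prop) (T s n l X : nat) (tp : nat -> nat) :
  tp 0 = n -> tp 1 = l -> 2 <= n ->
  X = 11 * n + 7 * l ->
  (forall r0 r7 r8 r10 r11 r12 r13 r14 r15 h,
    (forall i, i < 14 -> h (X + 18 + i) = tp (i + 2)) ->
    (forall x, 16 <= x -> x != X -> (x < X + 18) || (X + 32 <= x) -> h x = tp x) ->
    decides swap_program A T (s + 51) 51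
      [:: r0; X + 32; 1; 4 * n - 16; n; l; 16; r7; r8; X + 18; r10; r11; r12; r13; r14; r15] h) ->
  decides swap_program A T s 0 (mkseq tp 16) tp.
Proof.
move=> tp0 tp1 n2 XE cont; rewrite /mkseq /= tp0 tp1.
steps 6.
regs [:: X; 3 * n + 2 * l; tp 2; tp 3; tp 4; tp 5; tp 6; tp 7; tp 8; tp 9; tp 10; tp 11;
  tp 12; tp 13; tp 14; tp 15].
steps 5.
regs [:: X; X + 18; 1; tp 3; tp 4; tp 5; tp 6; tp 7; tp 8; tp 9; tp 10; tp 11;
  tp 12; tp 13; tp 14; tp 15].
steps 27.
match goal with |- context [set_nth] => idtac | |- decides _ _ _ _ _ _ ?h => set h0 := h end.
(* The 14 stores made since this value was saved went to [X + 18] and above. *)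
have -> : h0 X = 3 * n + 2 * l.
  by rewrite /h0; do 14 (rewrite upd_neq; last lia); rewrite upd_eq.
steps 13.
apply: decides_spend (_ : _ <= s + 51) _; first lia.
regs [:: 2 * n + l; X + 32; 1; 4 * n - 16; n; l; 16; tp 7; tp 8; X + 18; tp 10; tp 11; tp 12;
  tp 13; tp 14; tp 15].
apply: cont.
- move=> i i14; rewrite /h0 /upd.
  do 14 (case: eqP => [?|?]; first by congr tp; lia).
  lia.
- move=> x x16 xX xo; rewrite /h0.
  do 14 (rewrite upd_neq; last lia).
  by rewrite upd_neq.
Qed.

(** Each cell costs seven steps and the exit test one. Since [src + k <= dst], no cell is
    overwritten before it is read. *)
Lemma copy_correct (A : Prop) (T s k src dst r0 n l r7 r8 a r10 r11 r12 r13 r14 r15 : nat)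
    (h : nat -> nat) :
  16 <= src -> src + k <= dst ->
  (forall r1 r6 r7 h', (forall i, i < k -> h' (dst + i) = h (src + i)) ->
     (forall x, (x < dst) || (dst + k <= x) -> h' x = h x) ->
     decides swap_program A T (s + 7 * k + 1) 58
      [:: r0; r1; 1; 0; n; l; r6; r7; r8; a; r10; r11; r12; r13; r14; r15] h') ->
  decides swap_program A T s 51
      [:: r0; dst; 1; k; n; l; src; r7; r8; a; r10; r11; r12; r13; r14; r15] h.
Proof.
elim: k s src dst r7 h => [|k IH] s src dst r7 h src16 le_dst cont.
  by step; split=> // _; rewrite -addn1 -[s]addn0 -(muln0 7); apply: cont.
step; split=> // _; steps 6.
regs [:: r0; dst + 1; 1; k; n; l; src + 1; h src; r8; a; r10; r11; r12; r13; r14; r15].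
apply: IH; [lia|lia|] => r1 r6 r7' h' h'k h'o.
apply: decides_spend (_ : _ <= s + 7 * k.+1 + 1) _; first lia.
apply: cont.
- case=> [|i] ik; first by rewrite !addn0 h'o ?upd_eq //; lia.
  have := h'k i; rewrite -!addnA !add1n => ->; last by [].
  by rewrite upd_neq //; lia.
- by move=> x xo; rewrite h'o ?upd_neq //; lia.
Qed.

(** With [g] constantly 1 this is the degree of [w], with [val] the sum of its neighbours'
    indices. *)
Definition endpoint_sum (n : nat) (g : 'I_n -> nat) (es : seq ('I_n * 'I_n)) (w : 'I_n) : nat :=
  \sum_(p <- es) ((if p.1 == w then g p.2 else 0) + (if p.2 == w then g p.1 else 0)).

(** The four stores of the loop body in their order, which makes this convertible with the heap
    found by symbolic execution. *)
Definition edge_heap (d n u v : nat) (h : nat -> nat) : nat -> nat :=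
  let h1 := upd h (d + u) (h (d + u) + 1) in
  let h2 := upd h1 (d + u + n) (h1 (d + u + n) + v) in
  let h3 := upd h2 (d + v) (h2 (d + v) + 1) in
  upd h3 (d + v + n) (h3 (d + v + n) + u).

Lemma edge_heap_below (d n u v : nat) (h : nat -> nat) (x : nat) :
  x < d -> edge_heap d n u v h x = h x.
Proof. by move=> xd; rewrite /edge_heap !upd_neq //; lia. Qed.

Lemma edge_heap_deg (d n u v w : nat) (h : nat -> nat) :
  u < n -> v < n -> w < n ->
  edge_heap d n u v h (d + w) =
  h (d + w) + ((if u == w then 1 else 0) + (if v == w then 1 else 0)).
Proof.
move=> un vn wn; rewrite /edge_heap /upd.
by repeat (case: eqP => ?; try lia); subst; lia.
Qed.

Lemma edge_heap_sum (d n u v w : nat) (h : nat -> nat) :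
  u < n -> v < n -> w < n ->
  edge_heap d n u v h (d + w + n) =
  h (d + w + n) + ((if u == w then v else 0) + (if v == w then u else 0)).
Proof.
move=> un vn wn; rewrite /edge_heap /upd.
by repeat (case: eqP => ?; try lia); subst; lia.
Qed.

(** All stores are at [d] or above, so the edges still to be read stay intact. *)
Lemma edge_loop_correct (A : Prop) (T s n l d a ptr r0 r3 r6 r7 r10 r12 r13 r14 r15 : nat)
    (es : seq ('I_n * 'I_n)) (h : nat -> nat) :
  16 <= ptr -> ptr + 2 * size es <= d ->
  (forall i, i < 2 * size es ->
    h (ptr + i) = nth 0 (flatten [seq [:: nat_of_ord p.1; nat_of_ord p.2] | p <- es]) i) ->
  (forall r3 r6 r7 r11 r12 h', (forall x, x < d -> h' x = h x) ->
     (forall w : 'I_n, h' (d + w) = h (d + w) + endpoint_sum (fun=> 1) es w) ->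
     (forall w : 'I_n, h' (d + w + n) = h (d + w + n) + endpoint_sum val es w) ->
     decides swap_program A T (s + 23 * size es + 1) 86
      [:: r0; d; 1; r3; n; l; r6; r7; 0; a; r10; r11; r12; r13; r14; r15] h') ->
  decides swap_program A T s 63
      [:: r0; d; 1; r3; n; l; r6; r7; size es; a; r10; ptr; r12; r13; r14; r15] h.
Proof.
elim: es s ptr r3 r6 r7 r12 h => [|[u v] es IH] s ptr r3 r6 r7 r12 h ptr16 le_d edges cont.
  step; split=> // _; rewrite -addn1 -[s]addn0 -(muln0 23).
  by apply: cont => // w; rewrite /endpoint_sum big_nil addn0.
have size_cons : size ((u, v) :: es) = (size es).+1 by [].
rewrite size_cons in le_d edges *.
step; split=> // _; steps 4.
have -> : h ptr = u by have := edges 0; rewrite addn0 => ->.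
have -> : h (ptr + 1) = v by rewrite edges //; lia.
have un := ltn_ord u; have vn := ltn_ord v.
steps 18.
match goal with |- decides _ _ _ _ _ _ ?g => rewrite -[g]/(edge_heap d n u v h) end.
match goal with |- context [?x :: [:: r13; r14; r15]] =>
  regs [:: r0; d; 1; d + v + n; n; l; nat_of_ord u; nat_of_ord v; size es; a; r10; ptr + 2; x;
    r13; r14; r15] end.
apply: IH; [lia|lia| |].
  move=> i ilt; rewrite edge_heap_below; last lia.
  by rewrite -addnA edges //; lia.
move=> r3' r6' r7' r11' r12' h' below deg sum.
apply: decides_spend (_ : _ <= s + 23 * size ((u, v) :: es) + 1) _; first by rewrite size_cons; lia.
apply: cont => [x xd|w|w].
- by rewrite below // edge_heap_below.
- by rewrite deg edge_heap_deg // -addnA /endpoint_sum big_cons.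
- by rewrite sum edge_heap_sum // -addnA /endpoint_sum big_cons.
Qed.

(** * Correctness of the peeling *)

(** Double counting: a neighbour of [w] is matched by exactly one listed pair, any other vertex by
    none. Without loops, [w] is at most one end of a pair. *)
Lemma endpoint_sum_nbrs (n : nat) (e : rel 'I_n) (es : seq ('I_n * 'I_n))
    (g : 'I_n -> nat) (w : 'I_n) :
  simple_graph e -> edge_listing e es ->
  endpoint_sum g es w = \sum_(u in active_nbrs e set0 w) g u.
Proof.
move=> [sym irr] [edges once].
transitivity (\sum_(p <- es) \sum_u if (p == (w, u)) || (p == (u, w)) then g u else 0).
  rewrite /endpoint_sum !big_seq; apply: eq_bigr => -[x y] /edges /= exy.
  have xy : x != y by apply: contraTneq exy => ->; rewrite irr.
  rewrite -big_mkcond /=; case: (eqVneq x w) xy => [->|xw] xy.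
    rewrite eq_sym (negPf xy) addn0 (big_pred1 y) // => u.
    rewrite !xpair_eqE eqxx /= (eq_sym y u) (eq_sym y w) (negPf xy) andbF orbF.
    by [].
  case: (eqVneq y w) => [->|yw].
    rewrite (big_pred1 x) // => u.
    by rewrite !xpair_eqE (negPf xw) eqxx andbT /= eq_sym.
  by rewrite big_pred0 // => u; rewrite !xpair_eqE (negPf xw) (negPf yw) andbF.
rewrite exchange_big [RHS]big_mkcond; apply: eq_bigr => u _.
rewrite inE in_set0 andbT -big_mkcond big_const_seq iter_addn_0 /=.
rewrite sym; case: (boolP (e w u)) => ewu; first by rewrite (once _ _ ewu) muln1.
rewrite (_ : count _ _ = 0) ?muln0 //.
apply/eqP; rewrite eqn0Ngt -has_count; apply/hasPn => p /edges ep.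
by apply/negP => /orP [] /eqP pE; rewrite pE /= ?(sym u) (negPf ewu) in ep.
Qed.

(** Both sides, doubled, are the sum of the degrees. The encoding does not contain the number of
    edges, so the program takes [n - 1] for it. *)
Lemma size_edge_listing (n : nat) (e : rel 'I_n) (es : seq ('I_n * 'I_n)) (r0 : 'I_n) :
  is_tree e -> edge_listing e es -> size es = n.-1.
Proof.
move=> te el; have [simple _ _] := te.
have [r [par [rank rt]]] := tree_rooting r0 te.
suff : (size es).*2 = n.-1.*2 by lia.
rewrite -(edge_sum_rooting simple rt).
transitivity (\sum_w endpoint_sum (fun=> 1) es w).
  rewrite /endpoint_sum exchange_big /= -muln2 -sum1_size big_distrl /=.
  apply: eq_bigr => -[x y] _; rewrite big_split /= -!big_mkcond /=.
  by rewrite (big_pred1 x) => [|w]; rewrite ?(big_pred1 y) // => [|w]; rewrite eq_sym.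
apply: eq_bigr => u _; rewrite (endpoint_sum_nbrs _ _ simple el).
rewrite big_mkcond; apply: eq_bigr => v _.
by rewrite !inE andbT (proj1 simple); case: (e _ _).
Qed.

(** The absolute difference, written as the program computes it by truncated subtractions. *)
Definition dist (x y : nat) := (x - y) + (y - x).

(** The arrays of the program in terms of the peeled set. Peeled vertices get degree zero, so the
    scan never takes them for leaves again; [a] and [b] count the tokens of color 1 in the part
    already hung below each vertex. *)
Definition peeling (n : nat) (e : rel 'I_n) (f g : 'I_n -> nat) (S : {set 'I_n})
    (par : 'I_n -> 'I_n) (rank : 'I_n -> nat) (deg nsum a b : 'I_n -> nat)
    (total : nat) : Prop :=
  [/\ partial_rooting e S par rank,
      forall v, deg v = if v \in S then 0 else #|active_nbrs e S v|,
      forall v, v \notin S -> nsum v = \sum_(u in active_nbrs e S v) u,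
      (forall v, a v = f v + \sum_(c in S | par c == v) a c) /\
      (forall v, b v = g v + \sum_(c in S | par c == v) b c) &
      total = \sum_(v in S) dist (a v) (b v)].

Lemma active_nbrsU1 (n : nat) (e : rel 'I_n) (S : {set 'I_n}) (v w : 'I_n) :
  active_nbrs e (v |: S) w = active_nbrs e S w :\ v.
Proof. by apply/setP => u; rewrite !inE negb_or andbCA. Qed.

(** Hanging [v] below [p] adds its count at [p] only; as [p] is unpeeled, this changes no summand
    over [S]. *)
Lemma subtree_count_peel (n : nat) (f a a' : 'I_n -> nat) (S : {set 'I_n})
    (par : 'I_n -> 'I_n) (v p : 'I_n) :
  v \notin S -> p \notin S -> p != v ->
  (forall w, a w = f w + \sum_(c in S | par c == w) a c) ->
  (forall w, a' w = if w == p then a p + a v else a w) ->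
  forall w, a' w = f w + \sum_(c in v |: S | [eta par with v |-> p] c == w) a' c.
Proof.
move=> vS pS pv aE a'E w; rewrite big_mkcondr big_setU1 //= eqxx.
rewrite [X in _ + (_ + X)](eq_bigr (fun c => if par c == w then a c else 0)).
  rewrite -big_mkcondr !a'E (eq_sym v) (negPf pv) (eq_sym p).
  by case: eqP => [->|_]; [rewrite addnCA addnC (aE p) | exact: aE].
move=> c cS; have cv : c != v by apply: contraNneq vS => <-.
have cp : c != p by apply: contraNneq pS => <-.
by rewrite (negPf cv) a'E (negPf cp).
Qed.

(** The neighbour sum of a leaf is its only neighbour. The new arrays are given by pointwise
    equations so that the heap left by the stores can be plugged in. *)
Lemma peeling_step (n : nat) (e : rel 'I_n) (f g : 'I_n -> nat) (S : {set 'I_n})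
    (par : 'I_n -> 'I_n) (rank deg nsum a b : 'I_n -> nat) (total : nat) (v : 'I_n) :
  simple_graph e -> peeling e f g S par rank deg nsum a b total -> deg v = 1 ->
  v \notin S /\ exists p : 'I_n, [/\ nsum v = p, p != v, p \notin S &
    forall deg' nsum' a' b',
      (forall w, deg' w = if w == v then 0 else if w == p then deg p - 1 else deg w) ->
      (forall w, nsum' w = if w == p then nsum p - v else nsum w) ->
      (forall w, a' w = if w == p then a p + a v else a w) ->
      (forall w, b' w = if w == p then b p + b v else b w) ->
      exists par' rank', peeling e f g (v |: S) par' rank' deg' nsum' a' b'
        (total + dist (a v) (b v))].
Proof.
move=> simple [rt degE nsumE [aE bE] totE] deg1; have [sym irr] := simple.
have vS : v \notin S by move: deg1; rewrite degE; case: ifP.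
split=> //; have [p [Np pS evp pv]] : exists p,
    [/\ active_nbrs e S v = [set p], p \notin S, e v p & p != v].
  by apply: active_nbrs1 => //; rewrite -deg1 degE (negPf vS).
exists p; split=> //; first by rewrite nsumE // Np big_set1.
move=> deg' nsum' a' b' deg'E nsum'E a'E b'E.
have vNp : v \in active_nbrs e S p by rewrite inE evp.
have NU1 w : w \notin S -> w != p -> active_nbrs e (v |: S) w = active_nbrs e S w.
  move=> wS wp; rewrite active_nbrsU1; apply/setDidPl; rewrite disjoint_sym disjoints1.
  apply/negP; rewrite inE => /andP [ewv _].
  have : w \in active_nbrs e S v by rewrite inE sym ewv.
  by rewrite Np inE (negPf wp).
exists [eta par with v |-> p], [eta rank with v |-> #|S|]; split.
- exact: partial_rooting_peel.
- move=> w; rewrite deg'E !inE; case: eqP => //= /eqP wv.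
  case: (eqVneq w p) => [->|wp].
    by rewrite (negPf pS) degE (negPf pS) active_nbrsU1 (cardsD1 v) vNp add1n subn1.
  by rewrite degE; case: ifP => // /negbT wS; rewrite NU1.
- move=> w; rewrite !inE negb_or => /andP [wv wS]; rewrite nsum'E.
  case: (eqVneq w p) => [->|wp]; last by rewrite nsumE // NU1.
  by rewrite nsumE // active_nbrsU1 (big_setD1 v) //= addKn.
- by split; [apply: subtree_count_peel aE a'E | apply: subtree_count_peel bE b'E].
- rewrite big_setU1 //= totE addnC a'E b'E (eq_sym v) (negPf pv); congr (_ + _).
  apply: eq_bigr => c cS; have cp : c != p by apply: contraNneq pS => <-.
  by rewrite a'E b'E (negPf cp).
Qed.

Lemma sum_nat_int (I : finType) (P : pred I) (F : I -> nat) :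
  ((\sum_(i | P i) F i)%N%:Z = \sum_(i | P i) (F i)%:Z)%R.
Proof. by apply: (big_morph Posz). Qed.

(** With no leaf left, everything but [r] is peeled; then the differences of [a] and [b] form the
    flow, and [total] is the sum of its absolute values. *)
Lemma peeling_OPT (n : nat) (e : rel 'I_n) (f g : {ffun 'I_n -> 'I_2}) (S : {set 'I_n})
    (par : 'I_n -> 'I_n) (rank deg nsum a b : 'I_n -> nat) (total l : nat) (r : 'I_n) :
  is_tree e -> token_placement f ->
  peeling e (fun v => f v) (fun v => g v) S par rank deg nsum a b total ->
  (forall v, deg v <> 1) -> r \notin S ->
  OPT_le e f g l <-> a r = b r /\ total <= l.
Proof.
move=> te tf [rt degE _ [aE bE] totE] leafless rS; have [simple _ _] := te.
have SE : S = [set~ r].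
  by apply: (leafless_setC1 te rt) => // v vS; have := leafless v; rewrite degE (negPf vS).
rewrite SE in rt.
have SP v : (fun c => (c \in S) && (par c == v)) =1 (fun c => (c != r) && (par c == v)).
  by move=> c; rewrite SE in_setC1.
have flow : tree_flow r par (fun v => f v) (fun v => g v) (fun v => (a v)%:Z - (b v)%:Z)%R.
  move=> v; rewrite (aE v) (bE v) !(eq_bigl _ _ (SP v)) big_split /= sum_opp_int -!sum_nat_int.
  move: (\sum_(i | _) a i) (\sum_(i | _) b i) => x y; lia.
rewrite (OPT_le_flow _ simple rt tf flow).
have -> : \sum_(v | v != r) `|((a v)%:Z - (b v)%:Z)%R|%N = total.
  rewrite totE SE; apply: eq_big => [v|v _]; first by rewrite in_setC1.
  by rewrite /dist; lia.
by split=> -[H1 H2]; split=> //; lia.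
Qed.

(** The five stores of a peeling in their order. The counts of [v] are read from [h] because the
    first three stores lie at [d] or above. *)
Definition peel_heap (a d n v p : nat) (h : nat -> nat) : nat -> nat :=
  let h1 := upd h (d + v) 0 in
  let h2 := upd h1 (d + p) (h1 (d + p) - 1) in
  let h3 := upd h2 (d + p + n) (h2 (d + p + n) - v) in
  let h4 := upd h3 (a + p) (h3 (a + p) + h (a + v)) in
  upd h4 (a + p + n) (h4 (a + p + n) + h (a + v + n)).

Lemma peel_heapE (a d n v p w : nat) (h : nat -> nat) :
  a + n + n <= d -> v < n -> p < n -> w < n -> p != v ->
  let h' := peel_heap a d n v p h in
  [/\ h' (d + w) = if w == v then 0 else if w == p then h (d + p) - 1 else h (d + w),
      h' (d + w + n) = if w == p then h (d + p + n) - v else h (d + w + n),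
      h' (a + w) = if w == p then h (a + p) + h (a + v) else h (a + w) &
      h' (a + w + n) = if w == p then h (a + p + n) + h (a + v + n) else h (a + w + n)].
Proof.
move=> le_d vn pn wn pv h'; rewrite /h' /peel_heap /upd; split.
- by repeat (case: eqP => ?; try lia); subst; lia.
- by repeat (case: eqP => ?; try lia); subst; lia.
- by repeat (case: eqP => ?; try lia); subst; lia.
- by repeat (case: eqP => ?; try lia); subst; lia.
Qed.

(** The distance of the two counts at the root plus the truncated [total - l] is zero exactly when
    both conditions hold. *)
Lemma test_correct (T s n l d a q total r3 r6 r8 r11 r12 r13 r14 r15 : nat) (h : nat -> nat) (A : Prop) :
  16 <= a -> (A <-> h (a + q) = h (a + q + n) /\ total <= l) -> s + 12 <= T ->
  decides swap_program A T s 129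
    [:: total; d; 1; r3; n; l; r6; q; r8; a; 0; r11; r12; r13; r14; r15] h.
Proof.
move=> a16 AE leT; steps 9.
step; split=> res.
  steps 1; apply: decides_halt => //=; first lia.
  by split=> // _; apply/AE; lia.
steps 1; apply: decides_halt => //=; first lia.
by split=> // /AE; lia.
Qed.

(* [k] bounds the peelings and outer iterations still to come. *)
Definition peel_invariant (n a d : nat) (e : rel 'I_n) (f g : {ffun 'I_n -> 'I_2})
    (k i : nat) (pending S : {set 'I_n}) (q : 'I_n) (total : nat) (h : nat -> nat) : Prop :=
  [/\ exists par rank,
        peeling e (fun v => f v) (fun v => g v) S par rank (fun v => h (d + v))
          (fun v => h (d + v + n)) (fun v => h (a + v)) (fun v => h (a + v + n)) total,
      q \notin S, i <= n,
      forall j : 'I_n, j < i -> j \notin pending -> h (d + j) <> 1 &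
      (n - #|S|) + (n - i) <= k].

(** A unit of [k] is charged 40 steps, of which a peeling takes 34; the other 20 pay for the final
    test. *)
Definition outer_correct (T n l a d : nat) (e : rel 'I_n) (f g : {ffun 'I_n -> 'I_2})
    (k : nat) : Prop :=
  forall s i (S : {set 'I_n}) (q : 'I_n) total r3 r6 r8 r11 r12 r14 r15 h,
  peel_invariant a d e f g k i set0 S q total h -> s + 40 * k + 20 <= T ->
  decides swap_program (OPT_le e f g l) T s 90
    [:: total; d; 1; r3; n; l; r6; nat_of_ord q; r8; a; 0; r11; r12; i; r14; r15] h.

(** Among the scanned vertices only [v] may be a leaf. The 15 steps beyond the budget of
    [outer_correct] pay for a failed leaf test. *)
Definition inner_correct (T n l a d : nat) (e : rel 'I_n) (f g : {ffun 'I_n -> 'I_2})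
    (k : nat) : Prop :=
  forall s i (S : {set 'I_n}) (q v : 'I_n) total r3 r8 r11 r12 r14 r15 h,
  peel_invariant a d e f g k i [set v] S q total h -> s + 40 * k + 35 <= T ->
  decides swap_program (OPT_le e f g l) T s 94
    [:: total; d; 1; r3; n; l; nat_of_ord v; nat_of_ord q; r8; a; 0; r11; r12; i; r14; r15] h.

Lemma outer_step (T n l a d : nat) (e : rel 'I_n) (f g : {ffun 'I_n -> 'I_2}) (k : nat) :
  16 <= a -> is_tree e -> token_placement f ->
  (forall k', k = k'.+1 -> inner_correct T l a d e f g k') -> outer_correct T l a d e f g k.
Proof.
move=> a16 te tf IH s i S q total r3 r6 r8 r11 r12 r14 r15 h [[par [rank pl]] qS le_in lt_i meas] leT.
case: (leqP n i) => ni.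
  steps 1; step; split=> [_|]; last lia.
  apply: test_correct => //; last lia.
  by apply: (peeling_OPT l te tf pl) => // v; apply: lt_i; rewrite ?inE; have := ltn_ord v; lia.
case: k IH meas leT => [|k] IH meas leT; first lia.
steps 1; step; split=> [|_]; first lia.
steps 2; rewrite addn0.
apply: (IH k erefl _ _ S _ (Ordinal ni)); last lia.
split=> //; [by exists par, rank | lia | | lia].
move=> j ji; rewrite inE -val_eqE /= => jv; apply: lt_i; last by rewrite inE.
by lia.
Qed.

(** If [v] is no leaf, the scan resumes with the same measure. Otherwise [v] is peeled, and [p]
    becomes pending as the only vertex whose degree may have dropped to one. *)
Lemma inner_step (T n l a d : nat) (e : rel 'I_n) (f g : {ffun 'I_n -> 'I_2}) (k : nat) :
  16 <= a -> a + n + n <= d -> is_tree e -> outer_correct T l a d e f g k ->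
  (forall k', k = k'.+1 -> inner_correct T l a d e f g k') -> inner_correct T l a d e f g k.
Proof.
move=> a16 le_d te out IH s i S q v total r3 r8 r11 r12 r14 r15 h inv leT.
have [[par [rank pl]] qS le_in lt_i meas] := inv.
have settled : h (d + v) <> 1 -> peel_invariant a d e f g k i set0 S q total h.
  move=> nv; split=> //; first by exists par, rank.
  by move=> j ji _; case: (eqVneq j v) => [-> //|jv]; apply: lt_i; rewrite ?inE.
steps 2; step; split=> deg0; first by apply: out; [apply: settled|]; lia.
step; step; split=> deg1; last by step; apply: out; [apply: settled|]; lia.
have hv : h (d + v) = 1 by lia.
have [simple _ _] := te.
have [vS [p [pE pv pS next]]] := peeling_step simple pl hv.
case: k IH meas leT {out inv settled} => [|k] IH meas leT.
  (* The unpeeled vertex [q] makes the measure positive. *)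
  by have := ltn_card_notin qS; lia.
have vn := ltn_ord v; have pn := ltn_ord p.
have pvn : nat_of_ord p != v by [].
rewrite deg1; steps 3.
rewrite upd_neq; last lia.
rewrite pE.
steps 8.
match goal with |- decides _ _ _ _ _ _ ?g => set h3 := g end.
have h3_below x : x < d -> h3 x = h x.
  by move=> xd; rewrite /h3 !upd_neq //; lia.
steps 2; rewrite h3_below; last lia.
steps 2; rewrite h3_below; last lia.
steps 14; rewrite addn0.
match goal with |- decides _ _ _ _ _ _ ?g => rewrite -[g]/(peel_heap a d n v p h) end.
rewrite -[total + _ + _]addnA -/(dist _ _).
match goal with |- context [?x :: [:: i; _; _]] =>
  regs [:: total + dist (h (a + v)) (h (a + v + n)); d; 1; d + p + n; n; l; nat_of_ord p;
    nat_of_ord p; a + p + n; a; 0; r11; x; i; h (a + v); h (a + v + n)] end.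
have heapE (w : 'I_n) := peel_heapE h le_d vn pn (ltn_ord w) pvn.
apply: (IH k erefl _ _ (v |: S)); last lia.
split=> //.
- by apply: next => w; have [] := heapE w.
- by rewrite !inE negb_or pv.
- move=> j ji; rewrite inE => jp; have [-> _ _ _] := heapE j.
  case: eqP => // /eqP jv; rewrite ifN //.
  by apply: lt_i; rewrite ?inE.
- by rewrite cardsU1 vS; have := ltn_card_notin vS; lia.
Qed.

(** Simultaneous induction: the inner claim at [k] uses the outer one at [k], and both use the inner
    one at the predecessor. *)
Lemma peel_loop_correct (T n l a d : nat) (e : rel 'I_n) (f g : {ffun 'I_n -> 'I_2}) :
  16 <= a -> a + n + n <= d -> is_tree e -> token_placement f ->
  forall k, outer_correct T l a d e f g k.
Proof.
move=> a16 le_d te tf k.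
suff [] : outer_correct T l a d e f g k /\ inner_correct T l a d e f g k by [].
elim: k => [|k [_ IH]].
  by have out := outer_step a16 te tf; split; [exact: out | apply: inner_step => //; exact: out].
have inn k' : k.+1 = k'.+1 -> inner_correct T l a d e f g k' by case=> <-.
by have out := outer_step a16 te tf inn; split=> //; apply: inner_step.
Qed.

(** * Correctness of the whole program *)

Lemma encode_source (n : nat) (es : seq ('I_n * 'I_n)) (f g : {ffun 'I_n -> 'I_2}) (l : nat)
    (v : 'I_n) : encode es f g l (v + 2) = f v.
Proof.
rewrite addn2 /encode /= nth_cat size_map size_enum_ord ltn_ord.
by rewrite (nth_map v) ?size_enum_ord // nth_ord_enum.
Qed.

Lemma encode_target (n : nat) (es : seq ('I_n * 'I_n)) (f g : {ffun 'I_n -> 'I_2}) (l : nat)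
    (v : 'I_n) : encode es f g l (n + v + 2) = g v.
Proof.
rewrite addn2 /encode /= nth_cat size_map size_enum_ord ltnNge leq_addr /= addKn.
rewrite nth_cat size_map size_enum_ord ltn_ord.
by rewrite (nth_map v) ?size_enum_ord // nth_ord_enum.
Qed.

Lemma encode_edges (n : nat) (es : seq ('I_n * 'I_n)) (f g : {ffun 'I_n -> 'I_2}) (l i : nat) :
  encode es f g l (n + n + i + 2) =
  nth 0 (flatten [seq [:: nat_of_ord p.1; nat_of_ord p.2] | p <- es]) i.
Proof.
rewrite addn2 /encode /= -addnA.
by do 2 rewrite nth_cat size_map size_enum_ord ltnNge leq_addr /= addKn.
Qed.

Lemma size_flatten_pairs (T U : Type) (x y : T -> U) (s : seq T) :
  size (flatten [seq [:: x p; y p] | p <- s]) = 2 * size s.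
Proof. by elim: s => //= p s ->; rewrite mulnS. Qed.

Lemma encode_out (n : nat) (es : seq ('I_n * 'I_n)) (f g : {ffun 'I_n -> 'I_2}) (l x : nat) :
  2 + n + n + 2 * size es <= x -> encode es f g l x = 0.
Proof.
move=> lex; rewrite /encode nth_default //=.
by rewrite !size_cat 2!size_map size_enum_ord size_flatten_pairs; lia.
Qed.

Lemma endpoint_sum_degree (n : nat) (e : rel 'I_n) (es : seq ('I_n * 'I_n)) (w : 'I_n) :
  simple_graph e -> edge_listing e es ->
  endpoint_sum (fun=> 1) es w = #|active_nbrs e set0 w|.
Proof. by move=> simple el; rewrite (endpoint_sum_nbrs _ _ simple el) sum1_card. Qed.

(** The factor 131 is 28 for copying, 23 for the edges and 80 for the peeling; the additive
    constants fit into the extra 131. *)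
Lemma swap_program_correct (n : nat) (e : rel 'I_n) (es : seq ('I_n * 'I_n))
    (f g : {ffun 'I_n -> 'I_2}) (l : nat) :
  is_tree e -> edge_listing e es -> token_placement f ->
  decides swap_program (OPT_le e f g l) (131 * n.+1) 0 0
    (mkseq (encode es f g l) 16) (encode es f g l).
Proof.
move=> te el tf; have [simple _ _] := te.
have [v0 fv0] := tf ord0; have [v1 fv1] := tf ord_max.
have n2 : 2 <= n.
  have v01 : nat_of_ord v0 != v1.
    by apply/eqP => /val_inj E; move: fv1; rewrite -E fv0 => /(congr1 val).
  by have := ltn_ord v0; have := ltn_ord v1; lia.
have sz := size_edge_listing v0 te el.
have out x : 4 * n <= x -> encode es f g l x = 0 by move=> lex; apply: encode_out; lia.
set tp := encode es f g l.
apply: (@boot_correct _ _ _ n l (11 * n + 7 * l)) => // r0 r7 r8 r10 r11 r12 r13 r14 r15 h.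
set X := 11 * n + 7 * l => h_low h_same.
have leX : 11 * n <= X by rewrite /X; lia.
apply: copy_correct; [by [] | lia | ] => r1 r6 {}r7 h1 h1_copied h1_same.
(* The first 14 cells were moved by the boot code and the others by the copy loop; past the input
   both sides are zero. *)
have tape i : h1 (X + 18 + i) = tp (i + 2).
  case: (ltnP i 14) => i14; first by rewrite h1_same ?h_low //; lia.
  case: (ltnP i (4 * n - 2)) => i4n.
    have := h1_copied (i - 14); rewrite (_ : X + 32 + (i - 14) = X + 18 + i); last lia.
    rewrite (_ : 16 + (i - 14) = i + 2); last lia.
    by move=> ->; [apply: h_same|]; lia.
  by rewrite h1_same ?h_same ?[tp _]out //; lia.
have [a aE] : {a | a = X + 18} by exists (X + 18).
rewrite -aE in tape *; steps 5.
set d := a + 4 * n.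
regs [:: r0; d; 1; 4 * n; n; l; r6; r7; size es; a; r10; a + 2 * n; r12; r13; r14; r15].
apply: edge_loop_correct; [lia | by rewrite /d sz; lia | |].
  move=> i ilt; rewrite -(encode_edges es f g l) -[encode _ _ _ _]/tp -tape; congr h1; lia.
move=> {}r3 {}r6 {}r7 {}r11 {}r12 h2 h2_below h2_deg h2_sum.
steps 4.
have n0 : 0 < n by lia.
(* The arrays of degrees and neighbour sums lie in untouched memory, hence start at zero. *)
have h1_out (i : nat) : 4 * n <= i -> h1 (a + i) = 0 by move=> i4n; rewrite tape; apply: out; lia.
(* The measure is [2 * n]: all vertices are unpeeled and unscanned. Vertex 0 matches the initial
   value of register 7. *)
have init : peel_invariant a d e f g (2 * n) 0 set0 set0 (Ordinal n0) 0 h2.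
  split=> //; rewrite ?inE ?cards0 //; last lia.
  exists id, (fun=> n); split=> [|v|v _||].
  - exact: partial_rooting0.
  - rewrite inE h2_deg (endpoint_sum_degree _ simple el) /d -addnA h1_out //; lia.
  - rewrite h2_sum (endpoint_sum_nbrs _ _ simple el) /d -!addnA h1_out //; lia.
  - split=> v; rewrite big_pred0 ?addn0 => [|c]; rewrite ?inE //.
      by rewrite h2_below ?tape ?[tp _]encode_source //; have := ltn_ord v; rewrite /d; lia.
    rewrite h2_below; last by have := ltn_ord v; rewrite /d; lia.
    by rewrite -(encode_target es f g l v) -addnA tape (addnC v).
  - by rewrite big_set0.
have loop : outer_correct (131 * n.+1) l a d e f g (2 * n).
  by apply: peel_loop_correct => //; rewrite /d; lia.
apply: (loop _ _ set0 (Ordinal n0)); first exact: init.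
by rewrite sz; lia.
Qed.

Theorem mainTheorem10 :
  exists (P : seq instr) (K : nat),
    forall (n : nat) (e : rel 'I_n) (es : seq ('I_n * 'I_n))
           (f0 ft : {ffun 'I_n -> 'I_2}) (l : nat),
      is_tree e -> edge_listing e es ->
      token_placement f0 -> token_placement ft ->
      exists t, t <= K * n.+1 /\
        halted P (run P t (Config 0 (encode es f0 ft l))) /\
        (memory (run P t (Config 0 (encode es f0 ft l))) 0 != 0 <-> OPT_le e f0 ft l).
Proof.
exists swap_program, 131 => n e es f0 ft l te el tf0 _.
(* At the start the registers hold the first 16 cells of the input. *)
have mem : encode es f0 ft l =1 split_mem (mkseq (encode es f0 ft l) 16) (encode es f0 ft l).
  by move=> x; rewrite /split_mem; case: ifP => // x16; rewrite nth_mkseq.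
have [t res] := swap_program_correct te el tf0 (c := Config 0 _) erefl mem.
by exists t.
Qed.
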